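(* For every $m\in\mathbb Z$, \[ \mathcal A=\bigcap_{k\in\mathbb Z}\mathcal T_k=\mathcal T_{m-1}\cap\mathcal T_m\cap\mathcal T_{m+1},\qquad\text{where }\mathcal T_k=\mathbb Z[\mathbb P][x_k^{\pm1},x_{k+1}^{\pm1}]. \]
   Context: Fix positive integers $\ell_1,\ell_2$ and independent variables $p_{i,k}$ ($i=1,2$, $1\le k\le\ell_i$), $p_{i,0}=1$. Let $\mathbb P$ be the group of Laurent monomials in the $p_{i,k}$ and $\mathbb Z[\mathbb P]$ its group ring; $\mathcal F=\mathbb Q(p_{i,k})(x_1,x_2)$ with $x_1,x_2$ independent. Put $P_1(z)=1+\sum_{k=1}^{\ell_1}p_{1,k}z^k$, $P_2(z)=1+\sum_{k=1}^{\ell_2}p_{2,k}z^k$, $\overline P_i(z)=z^{\ell_i}P_i(z^{-1})/p_{i,\ell_i}$. Define $x_k\in\mathcal F$ for all $k\in\mathbb Z$ from $x_1,x_2$ by $x_{k+1}x_{k-1}=P_1(x_k)$ if $k\equiv1$, $P_2(x_k)$ if $k\equiv2$, $\overline P_1(x_k)$ if $k\equiv3$, $\overline P_2(x_k)$ if $k\equiv0\pmod4$. Let $\mathcal A$ be the $\mathbb Z[\mathbb P]$-subalgebra of $\mathcal F$ generated by all $x_k$. *)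

(* Defs.v *)
(* The field F = Q(p_{i,k})(x_1,x_2) is realized as the
   fraction field of the integer multivariate polynomial ring in
   l1 + l2 + 2 variables (Frac(Z[vars]) = Q(vars)).
   Variable layout: index j-1 (1<=j<=l1) is p_{1,j};
   index l1+j-1 (1<=j<=l2) is p_{2,j}; index l1+l2 is x_1; index l1+l2+1 is x_2. *)
From HB Require Import structures.
From mathcomp Require Import all_boot all_order all_algebra.
From mathcomp Require Import fraction.
From mathcomp Require Import mpoly.
Unset Strict Implicit. Unset Printing Implicit Defensive.
Import Order.TTheory GRing.Theory Num.Theory.
Local Open Scope ring_scope.

Definition nvars (l1 l2 : nat) : nat := (l1 + l2).+2.

Definition Fld (l1 l2 : nat) := {fraction {mpoly int[nvars l1 l2]}}.

Definition var (l1 l2 : nat) (j : nat) : Fld l1 l2 :=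
  tofrac ('X_(@inord (l1 + l2).+1 j) : {mpoly int[nvars l1 l2]}).

Definition pv (l1 l2 : nat) (i j : nat) : Fld l1 l2 :=
  if j == 0%N then 1
  else if i == 1%N then var l1 l2 (j.-1) else var l1 l2 (l1 + j.-1).

Definition ell (l1 l2 : nat) (i : nat) : nat := if i == 1%N then l1 else l2.

Definition Ppol (l1 l2 : nat) (i : nat) (z : Fld l1 l2) : Fld l1 l2 :=
  \sum_(0 <= k < (ell l1 l2 i).+1) pv l1 l2 i k * z ^+ k.

(* Pbar_i(z) = z^{l_i} P_i(z^{-1}) / p_{i,l_i}, written as the polynomial
   (sum_{k=0}^{l_i} p_{i,k} z^{l_i - k}) / p_{i,l_i} *)
Definition Pbar (l1 l2 : nat) (i : nat) (z : Fld l1 l2) : Fld l1 l2 :=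
  (\sum_(0 <= k < (ell l1 l2 i).+1) pv l1 l2 i k * z ^+ (ell l1 l2 i - k))
    / pv l1 l2 i (ell l1 l2 i).

(* exchange polynomial used in x_{k+1} x_{k-1} = Q_k(x_k) *)
Definition Qk (l1 l2 : nat) (k : int) (z : Fld l1 l2) : Fld l1 l2 :=
  let r := (k %% 4)%Z in
  if r == 1 then Ppol l1 l2 1 z
  else if r == 2 then Ppol l1 l2 2 z
  else if r == 3 then Pbar l1 l2 1 z
  else Pbar l1 l2 2 z.

(* fwd n = (x_{n+1}, x_{n+2}) *)
Fixpoint fwd (l1 l2 : nat) (n : nat) : Fld l1 l2 * Fld l1 l2 :=
  match n with
  | 0 => (var l1 l2 (l1 + l2), var l1 l2 (l1 + l2).+1)
  | n'.+1 => let ab := fwd l1 l2 n' in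
             (ab.2, Qk l1 l2 (n'.+2)%:Z ab.2 / ab.1)
  end.

(* bwd n = (x_{1-n}, x_{2-n}) *)
Fixpoint bwd (l1 l2 : nat) (n : nat) : Fld l1 l2 * Fld l1 l2 :=
  match n with
  | 0 => (var l1 l2 (l1 + l2), var l1 l2 (l1 + l2).+1)
  | n'.+1 => let ab := bwd l1 l2 n' in
             (Qk l1 l2 (1 - n'%:Z) ab.1 / ab.2, ab.1)
  end.

Definition xs (l1 l2 : nat) (k : int) : Fld l1 l2 :=
  if (1 <= k)%R then (fwd l1 l2 `|k - 1|%N).1 else (bwd l1 l2 `|1 - k|%N).1.

Definition pmono (l1 l2 : nat) (e : {ffun 'I_(l1 + l2) -> int}) : Fld l1 l2 :=
  \prod_(i : 'I_(l1 + l2)) var l1 l2 i ^ e i.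

Definition inT (l1 l2 : nat) (k : int) (y : Fld l1 l2) : Prop :=
  exists s : seq (int * {ffun 'I_(l1 + l2) -> int} * int * int),
    y = \sum_(t <- s) (t.1.1.1)%:~R * pmono l1 l2 t.1.1.2
                      * xs l1 l2 k ^ t.1.2 * xs l1 l2 (k + 1) ^ t.2.

Definition inA (l1 l2 : nat) (y : Fld l1 l2) : Prop :=
  exists s : seq (int * {ffun 'I_(l1 + l2) -> int} * seq int),
    y = \sum_(t <- s) (t.1.1)%:~R * pmono l1 l2 t.1.2
                      * \prod_(k <- t.2) xs l1 l2 k.

(* Main.v *)
Require Import Defs.
From HB Require Import structures.
From mathcomp Require Import all_boot all_order all_algebra.
From mathcomp Require Import fraction.
From mathcomp Require Import mpoly.
From mathcomp Require Import ring zify.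
Import Order.TTheory GRing.Theory Num.Theory.
Local Open Scope ring_scope.

(* Write R = Z[P] and let a, b, c, d be four consecutive variables, so that
   ac = Q(b) and bd = S(c) with Q(0) = S(0) = 1.  Comparing Laurent expansions
   in c over R[b^±1] gives T(a,b) ∩ T(b,c) = R[a, b^±1, c], and likewise
   T(b,c) ∩ T(c,d) = R[b, c^±1, d].  Since 1 = bd - c s(c), large powers of this
   identity split R[a, b^±1, c] as R[a,b,c,d] + R[b^±1, c]; hence the triple
   intersection is R[a,b,c,d].  Reciprocity of the exchange polynomials makes
   R[x_{m-1}, ..., x_{m+2}] independent of m, so it is the whole algebra A; the
   Laurent phenomenon comes out as a by-product instead of being an ingredient.
   Subrings of the ambient field are Prop-valued predicates. *)

(** * Subrings of a field: adjunction, fractions, transcendence, Laurent expansions *)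

Section Subrings.
Context {F : fieldType}.
Implicit Types (D E : F -> Prop) (s : seq F) (p q r : {poly F}) (a b c x y z : F).

Definition subring D : Prop :=
  [/\ D 1, forall x y, D x -> D y -> D (x - y)
         & forall x y, D x -> D y -> D (x * y)].

(** The subring generated by [D] and [s]. Because of [adj_one], [D] may be any predicate; [adj D
    [::]] is thus the subring generated by a possibly infinite family. *)
Inductive adj D s : F -> Prop :=
| adj_base x : D x -> adj D s x
| adj_gen x : x \in s -> adj D s x
| adj_one : adj D s 1
| adj_sub x y : adj D s x -> adj D s y -> adj D s (x - y)
| adj_mul x y : adj D s x -> adj D s y -> adj D s (x * y).

Definition quot D z : Prop := exists u v, [/\ D u, D v, v != 0 & z = u / v].

Definition polyin D p : Prop := forall i, D p`_i.

Definition trans D c : Prop := forall p, polyin D p -> p.[c] = 0 -> p = 0.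

Lemma adj_subring D s : subring (adj D s).
Proof. by split; [exact: adj_one | exact: adj_sub | exact: adj_mul]. Qed.

Section Closure.
Variables (D : F -> Prop) (hD : subring D).

Lemma sr1 : D 1. Proof. by case: hD. Qed.
Lemma srB x y : D x -> D y -> D (x - y). Proof. by case: hD => _ h _; exact: h. Qed.
Lemma srM x y : D x -> D y -> D (x * y). Proof. by case: hD => _ _; exact. Qed.
Lemma sr0 : D 0. Proof. by rewrite -(subrr 1); apply: srB; exact: sr1. Qed.
Lemma srN x : D x -> D (- x).
Proof. by move=> h; rewrite -sub0r; apply: srB => //; exact: sr0. Qed.
Lemma srD x y : D x -> D y -> D (x + y).
Proof. by move=> hx hy; rewrite -[y]opprK; apply: srB => //; exact: srN. Qed.
Lemma srX n x : D x -> D (x ^+ n).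
Proof.
by move=> h; elim: n => [|n IH]; [exact: sr1|rewrite exprS; exact: srM].
Qed.
Lemma srMn n x : D x -> D (x *+ n).
Proof.
by move=> h; elim: n => [|n IH]; [exact: sr0|rewrite mulrS; exact: srD].
Qed.
Lemma sr_sum (I : Type) (u : seq I) (P : pred I) (f : I -> F) :
  (forall i, P i -> D (f i)) -> D (\sum_(i <- u | P i) f i).
Proof. by move=> h; apply: big_ind => //; [exact: sr0|exact: srD]. Qed.
Lemma sr_prod (I : Type) (u : seq I) (P : pred I) (f : I -> F) :
  (forall i, P i -> D (f i)) -> D (\prod_(i <- u | P i) f i).
Proof. by move=> h; apply: big_ind => //; [exact: sr1|exact: srM]. Qed.
Lemma sr_horner p x : polyin D p -> D x -> D p.[x].
Proof.
by move=> hp hx; rewrite horner_coef; apply: sr_sum => i _; apply/srM/srX.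
Qed.

Lemma polyin0 : polyin D 0. Proof. by move=> i; rewrite coef0; exact: sr0. Qed.
Lemma polyinD p q : polyin D p -> polyin D q -> polyin D (p + q).
Proof. by move=> hp hq i; rewrite coefD; exact: srD. Qed.
Lemma polyinB p q : polyin D p -> polyin D q -> polyin D (p - q).
Proof. by move=> hp hq i; rewrite coefB; exact: srB. Qed.
Lemma polyinM p q : polyin D p -> polyin D q -> polyin D (p * q).
Proof. by move=> hp hq i; rewrite coefM; apply: sr_sum => j _; exact: srM. Qed.
Lemma polyinC x : D x -> polyin D x%:P.
Proof. by move=> hx i; rewrite coefC; case: ifP => _ //; exact: sr0. Qed.
Lemma polyinXn n : polyin D 'X^n.
Proof. by move=> i; rewrite coefXn; case: eqP => _; [exact: sr1|exact: sr0]. Qed.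
Lemma polyin_exp n p : polyin D p -> polyin D (p ^+ n).
Proof.
move=> hp; elim: n => [|n IH]; last by rewrite exprS; exact: polyinM.
by rewrite expr0; apply: polyinC; exact: sr1.
Qed.
Lemma polyinMXn_inv p n : polyin D (p * 'X^n) -> polyin D p.
Proof. by move=> hp i; have := hp (i + n)%N; rewrite coefMXn ltnNge leq_addl addnK. Qed.
Lemma polyin_poly n (f : nat -> F) :
  (forall i, (i < n)%N -> D (f i)) -> polyin D (\poly_(i < n) f i).
Proof. by move=> h i; rewrite coef_poly; case: ifP => [/h //|_]; exact: sr0. Qed.

End Closure.

(** Recursive conjunction, so that on an explicit list of generators it computes to one goal per
    generator. *)
Fixpoint allin D s : Prop := if s is a :: s' then D a /\ allin D s' else True.

Lemma allin_mem D s : allin D s -> forall x, x \in s -> D x.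
Proof.
elim: s => //= a s IH [ha hs] x; rewrite inE => /orP[/eqP-> //|]; exact: IH.
Qed.

Lemma adj_min D E s y :
  subring E -> (forall x, D x -> E x) -> allin E s -> adj D s y -> E y.
Proof.
move=> hE hDE hs; elim=> {y} [x /hDE //|x|||].
- exact: allin_mem.
- exact: sr1.
- by move=> x y _ hx _; exact: srB.
- by move=> x y _ hx _; exact: srM.
Qed.

Lemma quot_base D z : subring D -> D z -> quot D z.
Proof. by move=> hD hz; exists z, 1; split; rewrite ?oner_eq0 ?divr1 //; exact: sr1. Qed.

Lemma quot_subring D : subring D -> subring (quot D).
Proof.
move=> hD; split.
- by apply: quot_base => //; exact: sr1.
- move=> _ _ [u [v [hu hv v0 ->]]] [u' [v' [hu' hv' v0' ->]]].
  exists (u * v' - u' * v), (v * v'); split; rewrite ?mulf_neq0 //.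
  + by apply: srB => //; exact: srM.
  + exact: srM.
  + by field; rewrite v0 v0'.
- move=> _ _ [u [v [hu hv v0 ->]]] [u' [v' [hu' hv' v0' ->]]].
  exists (u * u'), (v * v'); split; rewrite ?mulf_neq0 //; try exact: srM.
  by field; rewrite v0 v0'.
Qed.

Lemma quot_inv D z : subring D -> quot D z -> quot D z^-1.
Proof.
move=> hD [u [v [hu hv v0 ->]]]; have [->|u0] := eqVneq u 0.
  by rewrite mul0r invr0; apply: quot_base => //; exact: sr0.
by exists v, u; split => //; rewrite invf_div.
Qed.

Lemma quot_min D E y :
  subring E -> (forall x, E x -> E x^-1) -> (forall x, D x -> E x) -> quot D y -> E y.
Proof.
by move=> hE hV hDE [u [v [hu hv v0 ->]]]; apply: srM => //; [exact: hDE|exact/hV/hDE].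
Qed.

Lemma trans_mono D E c : (forall x, D x -> E x) -> trans E c -> trans D c.
Proof. by move=> h hc p hp; apply: hc => i; apply: h. Qed.

Lemma quot_denom D n (f : nat -> F) : subring D -> (forall i, quot D (f i)) ->
  exists v, [/\ D v, v != 0 & forall i, (i < n)%N -> D (v * f i)].
Proof.
move=> hD hf; elim: n => [|n [v [hv v0 hvf]]].
  by exists 1; split; rewrite ?oner_eq0 //; exact: sr1.
have [u [w [hu hw w0 e]]] := hf n.
exists (w * v); split; rewrite ?mulf_neq0 //; first exact: srM.
move=> i; rewrite ltnS leq_eqVlt => /orP[/eqP->|lt_in].
  by rewrite e (_ : _ * _ = v * u); [exact: srM | field].
by rewrite -mulrA; apply: srM => //; exact: hvf.
Qed.

(** Multiplying by a common denominator of the coefficients turns a relation over the fraction field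
    into one over [D]. *)
Lemma trans_quot D c : subring D -> trans D c -> trans (quot D) c.
Proof.
move=> hD hc p hp pc0; have [v [hv v0 hvp]] := quot_denom D (size p) _ hD hp.
suff /eqP: v *: p = 0 by rewrite scaler_eq0 (negPf v0) => /eqP.
apply: hc; last by rewrite hornerZ pc0 mulr0.
move=> i; rewrite coefZ; case: (ltnP i (size p)) => [/hvp //|le].
by rewrite nth_default // mulr0; exact: sr0.
Qed.

Lemma trans_neq0 D c : subring D -> trans D c -> c != 0.
Proof.
move=> hD hc; apply/eqP => c0.
have /eqP := hc 'X (polyinXn _ hD 1) (etrans (hornerX c) c0).
by rewrite polyX_eq0.
Qed.

Lemma adj1P D a y : subring D -> adj D [:: a] y -> exists2 p, polyin D p & y = p.[a].
Proof.
move=> hD; elim=> {y} [x hx|x|||].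
- by exists x%:P; rewrite ?hornerC //; exact: polyinC.
- rewrite inE => /eqP->; exists ('X^1); first exact: polyinXn.
  by rewrite hornerXn.
- by exists 1%:P; rewrite ?hornerC //; apply: polyinC => //; exact: sr1.
- move=> x y _ [p hp ->] _ [q hq ->]; exists (p - q); first exact: polyinB.
  by rewrite hornerD hornerN.
- move=> x y _ [p hp ->] _ [q hq ->]; exists (p * q); first exact: polyinM.
  by rewrite hornerM.
Qed.

(** Since ac lies in [D], every monomial d c^i a^j collapses to a coefficient times a pure power of
    c or of a. For a = c^-1 this is the Laurent expansion, with the constant term counted in [p]. *)
Lemma adj2_expand D a c y : subring D -> D (a * c) -> adj D [:: c; a] y ->
  exists p r, [/\ polyin D p, polyin D r & y = p.[c] + a * r.[a]].
Proof.
move=> hD hac hy.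
pose M z := exists p r, [/\ polyin D p, polyin D r & z = p.[c] + a * r.[a]].
have M0 : M 0.
  by exists 0, 0; split; rewrite ?horner0 ?mulr0 ?addr0 //; exact: polyin0.
have MD x z : M x -> M z -> M (x + z).
  move=> [p [r [hp hr ->]]] [p' [r' [hp' hr' ->]]].
  exists (p + p'), (r + r'); split; try exact: polyinD.
  by rewrite !hornerD; ring.
have Mmon d i j : D d -> M (d * c ^+ i * a ^+ j).
  move=> hd; have hn n : D (d * (a * c) ^+ n) by apply: srM => //; exact: srX.
  case: (leqP j i) => [le_ji|lt_ij].
    exists ((d * (a * c) ^+ j)%:P * 'X^(i - j)), 0; split.
    - by apply: polyinM => //; [exact: polyinC|exact: polyinXn].
    - exact: polyin0.
    - rewrite horner0 mulr0 addr0 hornerM hornerC hornerXn exprMn.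
      by rewrite -{1}(subnK le_ji) exprD; ring.
  exists 0, ((d * (a * c) ^+ i)%:P * 'X^((j - i).-1)); split.
  - exact: polyin0.
  - by apply: polyinM => //; [exact: polyinC|exact: polyinXn].
  - rewrite horner0 add0r hornerM hornerC hornerXn exprMn.
    have -> : j = (i + (j - i).-1.+1)%N by rewrite prednK ?subn_gt0 // subnKC // ltnW.
    by rewrite addKn /= exprD exprS; ring.
have {hy} : adj (adj D [:: c]) [:: a] y.
  apply: adj_min hy; first exact: adj_subring.
    by move=> x hx; apply/adj_base/adj_base.
  by do ![split]; [apply/adj_base/adj_gen|apply/adj_gen]; rewrite inE.
case/adj1P => [|P hP ->]; first exact: adj_subring.
rewrite horner_coef; apply: (big_ind M) => // j _.
have [p hp ->] := adj1P _ _ _ hD (hP j).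
rewrite horner_coef mulr_suml; apply: (big_ind M) => // i _.
exact: Mmon.
Qed.

(** Multiplication by c^n, n the size of [r], clears the negative powers. The coefficients of [r]
    then occupy the degrees below n and those of [p] the degrees from n on, so they vanish
    separately. *)
Lemma laurent_eq0 D c p r : subring D -> trans D c -> polyin D p -> polyin D r ->
  p.[c] + c^-1 * r.[c^-1] = 0 -> p = 0 /\ r = 0.
Proof.
move=> hD hc hp hr e; have c0 := trans_neq0 _ _ hD hc.
(* [r'] is [r] reversed: c^n c^-1 c^-i = c^(n-1-i). *)
set n := size r; pose r' := \poly_(i < n) r`_(n.-1 - i).
have e' : c ^+ n * (c^-1 * r.[c^-1]) = r'.[c].
  rewrite horner_coef horner_poly -/n mulrA big_distrr /=.
  rewrite (reindex_inj rev_ord_inj) /=; apply: eq_bigr => i _.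
  have -> : (n.-1 - i = n - i.+1)%N by rewrite -subn1 -subnDA add1n.
  have {1}-> : n = (i + (n - i.+1).+1)%N by rewrite -subSn // subSS subnKC // ltnW.
  have := expf_neq0 (n - i.+1) c0.
  rewrite exprD exprS exprVn => h0.
  by field; rewrite c0 h0.
have pr0 : p * 'X^n + r' = 0.
  apply: hc.
    apply: polyinD => //; first by apply: polyinM => //; exact: polyinXn.
    by apply: polyin_poly.
  by rewrite hornerD hornerM hornerXn -e' mulrC -mulrDr e mulr0.
split; apply/polyP => i; rewrite coef0.
  have := congr1 (fun q : {poly F} => q`_(i + n)) pr0.
  by rewrite coefD coefMXn ltnNge leq_addl addnK coef_poly ltnNge leq_addl addr0 coef0.
case: (ltnP i n) => [lt_in|le]; last by rewrite nth_default.
have := congr1 (fun q : {poly F} => q`_(n.-1 - i)) pr0.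
have lt : (n.-1 - i < n)%N.
  by rewrite (leq_ltn_trans (leq_subr _ _)) // prednK // (leq_ltn_trans _ lt_in).
rewrite coefD coefMXn lt coef_poly lt add0r coef0 subKn //.
by rewrite -ltnS prednK // (leq_ltn_trans _ lt_in).
Qed.

Lemma laurent_inj D c p r p' r' : subring D -> trans D c ->
  polyin D p -> polyin D r -> polyin D p' -> polyin D r' ->
  p.[c] + c^-1 * r.[c^-1] = p'.[c] + c^-1 * r'.[c^-1] -> p = p' /\ r = r'.
Proof.
move=> hD hc hp hr hp' hr' e.
have [|||/eqP+ /eqP] := laurent_eq0 D c (p - p') (r - r') hD hc.
- exact: polyinB.
- exact: polyinB.
- have -> : (p - p').[c] + c^-1 * (r - r').[c^-1]
     = (p.[c] + c^-1 * r.[c^-1]) - (p'.[c] + c^-1 * r'.[c^-1]).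
    by rewrite !(hornerD, hornerN); ring.
  by rewrite e subrr.
by rewrite !subr_eq0 => /eqP-> /eqP->.
Qed.

End Subrings.

(** * Algebraic independence under mutation, and comparison of Laurent expansions *)

Section Mutation.
Context {F : fieldType}.
Implicit Types (D E K R : F -> Prop) (p q r P Q S : {poly F}) (a b c d x y z : F).

(** This is (p - p(0)) / X, while [scalep z p] is p(zX). *)
Definition shiftp p : {poly F} := \poly_(i < size p) p`_i.+1.
Definition scalep z p : {poly F} := \poly_(i < size p) (p`_i * z ^+ i).

Lemma horner_shiftp p z : p.[z] = p`_0 + z * (shiftp p).[z].
Proof.
have {1}-> : p = \poly_(i < (size p).+1) p`_i.
  by apply/polyP=> i; rewrite coef_poly ltnS; case: leqP => // /ltnW le; rewrite nth_default.
rewrite !horner_poly big_ord_recl expr0 mulr1 mulr_sumr; congr (_ + _).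
by apply: eq_bigr => i _; rewrite /= /bump add1n exprS; ring.
Qed.

Lemma horner_scalep p x z : (scalep x p).[z] = p.[x * z].
Proof.
rewrite horner_poly horner_coef; apply: eq_bigr => i _.
by rewrite exprMn mulrA.
Qed.

Lemma polyin_shiftp D p : subring D -> polyin D p -> polyin D (shiftp p).
Proof. by move=> hD hp; apply: polyin_poly. Qed.

Lemma polyin_scalep D x p : subring D -> D x -> polyin D p -> polyin D (scalep x p).
Proof. by move=> hD hx hp; apply: polyin_poly => // i _; apply: srM => //; exact: srX. Qed.

Lemma polyinZ D x p : subring D -> D x -> polyin D p -> polyin D (x *: p).
Proof. by move=> hD hx hp i; rewrite coefZ; exact: srM. Qed.

Lemma coef0_eq1_neq0 p : p`_0 = 1 -> p != 0.
Proof. by apply: contra_eq_neq => ->; rewrite coef0 eq_sym oner_eq0. Qed.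

(** A relation p(q/c) = 0, multiplied by c^-1, is a Laurent relation in c with coefficients p_i q^i
    and only negative powers; hence every p_i vanishes. *)
Lemma trans_div K c (q : F) : subring K -> trans K c -> K q -> q != 0 -> trans K (q / c).
Proof.
move=> hK hc hq q0 p hp e.
have [|||_ r0] := laurent_eq0 K c 0 (scalep q p) hK hc.
- exact: polyin0.
- exact: polyin_scalep.
- by rewrite horner0 add0r horner_scalep e mulr0.
apply/polyP => i; rewrite coef0.
have /eqP := congr1 (fun u : {poly F} => u`_i) r0.
rewrite coef0 coef_poly; case: ltnP => [_|le _]; last by rewrite nth_default.
by rewrite mulf_eq0 expf_eq0 (negPf q0) andbF orbF => /eqP.
Qed.

(** Independence does not depend on the order of adjunction: a relation for c over R[d] is a double
    sum in c and d, which is regrouped as a relation for d over R[c]. *)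
Lemma trans_adj_sym R c d : subring R ->
  trans R c -> trans (adj R [:: c]) d -> trans (adj R [:: d]) c.
Proof.
move=> hR hc hd p hp pc0.
have /fin_all_exists [f hf] : forall i : 'I_(size p),
    exists q, polyin R q /\ p`_i = q.[d].
  by move=> i; have [q hq e] := adj1P R d _ hR (hp i); exists q.
pose N := (\max_(i < size p) size (f i))%N.
(* [g j] collects the coefficient of d^j as a polynomial in c. The index i is always below [size p],
   so the default 0 of [insub] is never reached. *)
pose g j := \poly_(i < size p) (if insub i is Some k then (f k)`_j else 0).
have gE j : (g j).[c] = \sum_(i < size p) (f i)`_j * c ^+ i.
  by rewrite horner_poly; apply: eq_bigr => i _; rewrite valK.
have hg j : polyin R (g j).
  apply: polyin_poly => // i _; case: insubP => [k _ _|_]; last exact: sr0.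
  exact: (hf k).1.
have h0 : \poly_(j < N) (g j).[c] = 0.
  apply: hd.
    apply: polyin_poly; first exact: adj_subring.
    move=> j _; apply: sr_horner; first exact: adj_subring.
      by move=> i; exact/adj_base/hg.
    by apply: adj_gen; rewrite inE.
  rewrite horner_poly; apply: etrans pc0; rewrite [RHS]horner_coef.
  under eq_bigr do rewrite gE mulr_suml.
  rewrite exchange_big; apply: eq_bigr => i _ /=.
  rewrite (hf i).2 (@horner_coef_wide _ N); last by rewrite /N; apply: (leq_bigmax i).
  by rewrite mulr_suml; apply: eq_bigr => j _; ring.
have g0 j : g j = 0.
  case: (ltnP j N) => [lt_jN|le_Nj].
    by apply: hc => //; have := congr1 (fun u : {poly F} => u`_j) h0;
       rewrite coef0 coef_poly lt_jN.
  apply/polyP => i; rewrite coef_poly coef0; case: ifP => // _.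
  case: insubP => // k _ _; apply: nth_default; apply: leq_trans le_Nj.
  by rewrite /N; apply: (leq_bigmax k).
apply/polyP => i; rewrite coef0; case: (ltnP i (size p)) => [lt|le]; last by rewrite nth_default.
rewrite (hf (Ordinal lt)).2 (_ : f _ = 0) ?horner0 //.
apply/polyP => j; rewrite coef0.
have := congr1 (fun u : {poly F} => u`_i) (g0 j).
by rewrite coef0 coef_poly lt insubT.
Qed.

(** Algebraic independence over [R], recorded in both orders and over fraction fields: expansions in
    either variable are compared with coefficients in the fraction field generated by the other. *)
Definition indep R b c : Prop :=
  trans (quot (adj R [:: b])) c /\ trans (quot (adj R [:: c])) b.

Lemma indep_sym R b c : indep R b c -> indep R c b.
Proof. by case. Qed.

Lemma trans_of_indep R b c : subring R -> indep R b c -> trans R c.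
Proof.
move=> hR [hc _]; apply: trans_mono hc => x hx.
by apply: quot_base; [exact: adj_subring|exact: adj_base].
Qed.

(** Over the fraction field of R[c] the new variable is a nonzero constant divided by b, so
    [trans_div] applies; [trans_adj_sym] supplies the other order. *)
Lemma indep_mutation R b c S : subring R -> polyin R S -> S != 0 ->
  indep R b c -> indep R c (S.[c] / b).
Proof.
move=> hR hS S0 hbc; have hc := trans_of_indep R b c hR hbc.
have hA s := adj_subring R s.
have hK s := quot_subring _ (hA s).
have hs : adj R [:: c] S.[c].
  by apply: sr_horner => // [i|]; [exact: adj_base|apply: adj_gen; rewrite inE].
have hd : trans (quot (adj R [:: c])) (S.[c] / b).
  apply: trans_div => //; first exact: hbc.2.
    exact: quot_base.
  by apply: contra_neq S0; exact: hc.
split=> //; apply: trans_quot => //; apply: trans_adj_sym => //.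
by apply: trans_mono hd => x hx; exact: quot_base.
Qed.

(** With a = q/c, the expansion of y in a is also an expansion in c over [K], where q is invertible.
    Uniqueness identifies its positive a-part with the negative c-part of the first expansion. Hence
    y is the nonnegative c-part of the first plus the positive a-part of the second, and both have
    coefficients in [D]. *)
Lemma laurent_cap D K a c (q : F) y : subring D -> subring K ->
  (forall x, D x -> K x) -> (forall x, K x -> K x^-1) -> trans K c ->
  D q -> q != 0 -> a * c = q ->
  adj D [:: c; c^-1] y -> adj D [:: a; a^-1] y -> adj D [:: c; a] y.
Proof.
move=> hD hK hDK hKV hc hq q0 hac hyc hya.
have c0 := trans_neq0 _ _ hK hc.
have a0 : a != 0 by apply: contra_neq q0 => a0; rewrite -hac a0 mul0r.
have [p [r [hp hr e]]] : exists p r, [/\ polyin D p, polyin D r & y = p.[c] + c^-1 * r.[c^-1]].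
  by apply: adj2_expand => //; rewrite mulVf //; exact: sr1.
have [p' [r' [hp' hr' e']]] :
    exists p r, [/\ polyin D p, polyin D r & y = p.[a] + a^-1 * r.[a^-1]].
  by apply: adj2_expand => //; rewrite mulVf //; exact: sr1.
have aE : a = q * c^-1 by rewrite -hac mulfK.
have aVE : a^-1 = q^-1 * c by rewrite aE invfM invrK.
(* [P] and [T] are the nonnegative and negative c-parts of the expansion of y in a, rewritten by a =
   q c^-1. *)
pose P := (p'`_0)%:P + 'X * (q^-1 *: scalep q^-1 r').
pose T := q *: scalep q (shiftp p').
have [|||||hP hT] := laurent_inj K c p r P T hK hc.
- by move=> i; exact: hDK.
- by move=> i; exact: hDK.
- apply: polyinD => //; first by apply: polyinC => //; exact: hDK.
  apply: polyinM => //; first exact: (polyinXn _ hK 1).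
  apply: polyinZ => //; first exact/hKV/hDK.
  by apply: polyin_scalep => //; [exact/hKV/hDK|move=> i; exact: hDK].
- by move=> i; apply: hDK; apply: polyinZ => //; apply: polyin_scalep => //; exact: polyin_shiftp.
- rewrite -e e' horner_shiftp.
  rewrite !(hornerD, hornerM, hornerX, hornerC, hornerZ, horner_scalep) -aE -aVE.
  by rewrite {1}aE {1}aVE; ring.
have -> : y = p.[c] + (p'.[a] - p'`_0).
  rewrite e hT hornerZ horner_scalep -aE (horner_shiftp p' a).
  by rewrite {2}aE; ring.
have hA := adj_subring D [:: c; a].
have hDA x : D x -> adj D [:: c; a] x by exact: adj_base.
apply: srD => //; last apply: srB => //.
- apply: sr_horner => // [i|]; [exact: hDA|by apply: adj_gen; rewrite !inE eqxx].
- by apply: sr_horner => // [i|]; [exact: hDA|apply: adj_gen; rewrite !inE eqxx orbT].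
- exact: hDA.
Qed.

(** * Rings generated by variables linked by exchange relations *)

Section Exchange.
Variables (R : F -> Prop) (hR : subring R).
Let hA s := adj_subring R s.

Lemma adj_horner s p z : polyin R p -> adj R s z -> adj R s p.[z].
Proof. by move=> hp hz; apply: sr_horner => // i; exact: adj_base. Qed.

(* Modulo c the relation bd = S(c) makes d the inverse of b, so the reciprocal
   polynomial Q' turns Q'(d) into a multiple of d^l Q(b) = d^l ac. *)
Lemma adj_exchange Q Q' S a b c d e l lam :
  polyin R Q -> polyin R S -> S`_0 = 1 -> c != 0 ->
  a * c = Q.[b] -> b * d = S.[c] -> c * e = Q'.[d] ->
  (size Q <= l.+1)%N -> R lam -> Q' = lam *: \poly_(i < l.+1) Q`_(l - i) ->
  adj R [:: a; b; c; d] e.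
Proof.
move=> hQ hS S0 c0 hac hbd hce szQ hlam hQ'.
pose t k := shiftp (S ^+ k).
have ht k : polyin R (t k) by apply: polyin_shiftp => //; exact: polyin_exp.
have tE k : (b * d) ^+ k = 1 + c * (t k).[c].
  rewrite hbd -horner_exp [LHS]horner_shiftp; congr (_ + _).
  by rewrite -[LHS]horner_coef0 horner_exp horner_coef0 S0 expr1n.
(* Once multiplied by c, the first term is lam d^l Q(b), whose k-th summand is lam Q_k (bd)^k
   d^(l-k). The subtracted sum removes the multiples of c in (bd)^k = 1 + c t_k(c), which leaves
   Q'(d). *)
have -> : e = lam * (d ^+ l * a - \sum_(k < l.+1) Q`_k * (t k).[c] * d ^+ (l - k)).
  apply: (mulfI c0); rewrite hce hQ' hornerZ horner_poly.
  rewrite (reindex_inj rev_ord_inj) /=.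
  under eq_bigr => i _ do rewrite subSS (subKn (leq_ord i)).
  have -> : c * (lam * (d ^+ l * a - \sum_(k < l.+1) Q`_k * (t k).[c] * d ^+ (l - k)))
     = lam * (d ^+ l * (a * c) - \sum_(k < l.+1) c * (Q`_k * (t k).[c] * d ^+ (l - k))).
    by rewrite -mulr_sumr; ring.
  congr (_ * _); apply/eqP; rewrite -subr_eq opprK hac (horner_coef_wide _ szQ) mulr_sumr.
  rewrite -big_split /=; apply/eqP/eq_bigr => i _.
  have -> : d ^+ l * (Q`_i * b ^+ i) = Q`_i * (b * d) ^+ i * d ^+ (l - i).
    by rewrite -{1}(subnK (leq_ord i)) exprD exprMn; ring.
  by rewrite tE; ring.
have hd : adj R [:: a; b; c; d] d by apply: adj_gen; rewrite !inE eqxx ?orbT.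
apply: srM => //; first exact: adj_base.
apply: srB => //.
  by apply: srM => //; [exact: srX|apply: adj_gen; rewrite !inE eqxx].
apply: sr_sum => // k _; apply: srM => //; last exact: srX.
apply: srM => //; first exact: adj_base.
by apply: adj_horner => //; apply: adj_gen; rewrite !inE eqxx ?orbT.
Qed.

(** Write g = h(c) / c^N. As S(0) = 1, X is coprime to S over [F], so X^N divides h S^n only if it
    divides h. The quotient has its coefficients among those of h, hence in [R]. *)
Lemma adj_cancel c S g n : trans R c -> polyin R S -> S`_0 = 1 ->
  adj R [:: c; c^-1] g -> adj R [:: c] (g * S.[c] ^+ n) -> adj R [:: c] g.
Proof.
move=> hc hS S0 hg hgS; have c0 := trans_neq0 _ _ hR hc.
have [N [h [hh eh]]] : exists N h, polyin R h /\ g * c ^+ N = h.[c].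
  elim: hg => [z hz|z||z w _ [N [h [hh eh]]] _ [N' [h' [hh' eh']]]
                    |z w _ [N [h [hh eh]]] _ [N' [h' [hh' eh']]]].
  - by exists 0%N, z%:P; rewrite hornerC mulr1; split=> //; exact: polyinC.
  - rewrite !inE => /orP[] /eqP->.
      by exists 0%N, 'X^1; rewrite hornerXn mulr1; split=> //; exact: polyinXn.
    exists 1%N, 1%:P; rewrite hornerC mulVf //; split=> //.
    by apply: polyinC => //; exact: sr1.
  - exists 0%N, 1%:P; rewrite hornerC mulr1; split=> //.
    by apply: polyinC => //; exact: sr1.
  - exists (N + N')%N, (h * 'X^N' - h' * 'X^N); split.
      by apply: polyinB => //; apply: polyinM => //; exact: polyinXn.
    by rewrite hornerD hornerN !hornerM !hornerXn -eh -eh' exprD; ring.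
  - exists (N + N')%N, (h * h'); split; first exact: polyinM.
    by rewrite !hornerM -eh -eh' exprD; ring.
have [h' hh' eh'] := adj1P _ _ _ hR hgS.
have : h * S ^+ n = h' * 'X^N.
  apply/eqP; rewrite -subr_eq0; apply/eqP/hc.
    apply: polyinB => //; apply: polyinM => //; [exact: polyin_exp|exact: polyinXn].
  by rewrite hornerD hornerN !hornerM horner_exp hornerXn -eh -eh'; ring.
move=> /(congr1 (fun u => 'X^N %| u)); rewrite dvdp_mulIr Gauss_dvdpl; last first.
  apply: coprimep_expl; apply: coprimep_expr; rewrite coprimep_sym coprimep_def.
  have -> : 'X = 'X - 0%:P :> {poly F} by rewrite subr0.
  rewrite -coprimep_def coprimep_XsubC rootE horner_coef0 S0; exact: oner_neq0.
case/dvdpP => k ek.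
have -> : g = k.[c].
  by apply: (mulIf (expf_neq0 N c0)); rewrite eh ek hornerM hornerXn.
apply: adj_horner; last by apply: adj_gen; rewrite inE.
by apply: (polyinMXn_inv _ k N); rewrite -ek.
Qed.

(** After expansion in a and c, the terms that lie visibly in neither summand are the monomials with
    negative powers of b and positive powers of a. Multiplying these by a power of 1 = bd - c s(c),
    with s = [shiftp S], distributes them over the two rings. *)
Lemma adj_split S a b c d y : polyin R S -> S`_0 = 1 -> b != 0 ->
  adj R [:: b] (a * c) -> b * d = S.[c] -> adj R [:: b; b^-1; c; a] y ->
  exists y1 y2, [/\ adj R [:: a; b; c; d] y1, adj R [:: b; b^-1; c] y2 & y = y1 + y2].
Proof.
move=> hS S0 b0 hac hbd hy.
pose A0 := adj R [:: a; b; c; d]; pose T := adj R [:: b; b^-1; c].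
pose W z := exists y1 y2, [/\ A0 y1, T y2 & z = y1 + y2].
have hA0 : subring A0 by exact: hA.
have hT : subring T by exact: hA.
have WA z : A0 z -> W z by exists z, 0; rewrite addr0; split=> //; exact: sr0.
have WT z : T z -> W z by exists 0, z; rewrite add0r; split=> //; exact: sr0.
have W0 : W 0 by apply: WA; exact: sr0.
have WD z w : W z -> W w -> W (z + w).
  move=> [z1 [z2 [h1 h2 ->]]] [w1 [w2 [h3 h4 ->]]].
  by exists (z1 + w1), (z2 + w2); split; [exact: srD|exact: srD|ring].
have A0a : A0 a by apply: adj_gen; rewrite !inE eqxx.
have A0b : A0 b by apply: adj_gen; rewrite !inE eqxx ?orbT.
have A0c : A0 c by apply: adj_gen; rewrite !inE eqxx ?orbT.
have A0d : A0 d by apply: adj_gen; rewrite !inE eqxx ?orbT.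
have Tb : T b by apply: adj_gen; rewrite !inE eqxx ?orbT.
have TVb : T b^-1 by apply: adj_gen; rewrite !inE eqxx ?orbT.
have Tc : T c by apply: adj_gen; rewrite !inE eqxx ?orbT.
have Tac : T (a * c) by apply: adj_min hac => //; exact: adj_base.
have hs := polyin_shiftp R S hR hS.
have key rho n i : R rho -> W (rho * b^-1 ^+ n * a ^+ i).
  move=> hrho.
  have one : b * d + - (c * (shiftp S).[c]) = 1 by rewrite hbd horner_shiftp S0; ring.
  (* Each term of the expanded power contains (bd)^n, cancelling b^-n, or c^i,
     which absorbs a^i through ac. *)
  rewrite -[_ * a ^+ i]mulr1 -[1 in X in W X](expr1n _ (i + n)) -one exprDn mulr_sumr.
  apply: (big_ind W) => // j _; rewrite mulrnAr.
  case: (leqP i j) => [le_ij|lt_ji].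
    apply: WT; apply: srMn => //; rewrite hbd.
    have -> : rho * b^-1 ^+ n * a ^+ i *
       (S.[c] ^+ (i + n - j) * (- (c * (shiftp S).[c])) ^+ j) =
       rho * b^-1 ^+ n * S.[c] ^+ (i + n - j) * (- (c * (shiftp S).[c])) ^+ (j - i)
        * (a * c) ^+ i * (- (shiftp S).[c]) ^+ i.
      have -> z : z ^+ j = z ^+ (j - i) * z ^+ i by rewrite -exprD subnK.
      by rewrite -{2}mulrN !exprMn; ring.
    do !apply: srM => //; do ?apply: srX => //; do ?apply: srN => //.
    - exact: adj_base.
    - exact: adj_horner.
    - by apply: srM => //; exact: adj_horner.
    - exact: adj_horner.
  apply: WA; apply: srMn => //.
  have -> : rho * b^-1 ^+ n * a ^+ i *
       ((b * d) ^+ (i + n - j) * (- (c * (shiftp S).[c])) ^+ j) =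
       rho * a ^+ i * (b * d) ^+ (i - j) * d ^+ n * (- (c * (shiftp S).[c])) ^+ j.
    have -> : (i + n - j = i - j + n)%N by rewrite addnBAC // ltnW.
    rewrite exprD [(b * d) ^+ n]exprMn exprVn; field.
    exact: expf_neq0.
  do !apply: srM => //; do ?apply: srX => //; do ?apply: srN => //.
  - exact: adj_base.
  - exact: srM.
  - by apply: srM => //; exact: adj_horner.
(* The c-part of the expansion over R[b^±1] already lies in [T]. In the a-part each coefficient is
   split into its nonnegative powers of b, which give elements of [A0], and its negative powers,
   which are the case of [key]. *)
have [||p [r [hp hr ->]]] := adj2_expand (adj R [:: b; b^-1]) a c y (hA _).
- apply: adj_min hac => //; first exact: adj_base.
  by split=> //; apply: adj_gen; rewrite !inE eqxx.
- apply: adj_min hy; first exact: adj_subring.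
    by move=> x hx; do 2!apply: adj_base.
  by do !split; try (by apply: adj_base; apply: adj_gen; rewrite !inE eqxx ?orbT);
     apply: adj_gen; rewrite !inE eqxx ?orbT.
apply: (WD).
  apply: WT; apply: sr_horner => // i; apply: adj_min (hp i) => //.
  exact: adj_base.
rewrite horner_coef mulr_sumr; apply: (big_ind W) => // i _.
have [|u [v [hu hv ->]]] := adj2_expand R b^-1 b _ hR _ (hr i).
  by rewrite mulVf //; exact: sr1.
rewrite mulrDl mulrDr; apply: (WD).
  apply: WA; do !apply: srM => //; last exact: srX.
  exact: adj_horner.
rewrite horner_coef mulr_sumr mulr_suml mulr_sumr; apply: (big_ind W) => // j _.
have -> : a * (b^-1 * (v`_j * b^-1 ^+ j) * a ^+ i) = v`_j * b^-1 ^+ j.+1 * a ^+ i.+1.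
  by rewrite !exprS; ring.
exact: key.
Qed.

(** Both memberships give Laurent expansions in b over the fraction field of R[c], the second one
    through d = S(c)/b. Equal nonnegative parts put p' over R[c]; equal negative parts put r'_i
    S(c)^(i+1) in R[c], and [adj_cancel] removes the power of S(c). *)
Lemma adj_cap_lower S b c d y : polyin R S -> S`_0 = 1 -> indep R b c ->
  b * d = S.[c] -> adj R [:: b; b^-1; c] y -> adj R [:: c; c^-1; b; d] y ->
  adj R [:: b; c; d] y.
Proof.
move=> hS S0 hbc hbd hy hy'.
have hc := trans_of_indep _ _ _ hR hbc.
have hK := quot_subring _ (hA [:: c]).
have c0 := trans_neq0 _ _ hR hc.
have b0 := trans_neq0 _ _ hK hbc.2.
have [||p [r [hp hr e]]] := adj2_expand (adj R [:: c]) b^-1 b y (hA _).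
- by rewrite mulVf //; exact: sr1.
- apply: adj_min hy; first exact: adj_subring.
    by move=> x hx; do 2!apply: adj_base.
  by do !split; try (by apply: adj_gen; rewrite !inE eqxx ?orbT);
     apply: adj_base; apply: adj_gen; rewrite !inE eqxx ?orbT.
have [||p' [r' [hp' hr' e']]] := adj2_expand (adj R [:: c; c^-1]) d b y (hA _).
- by rewrite mulrC hbd; apply: adj_horner => //; apply: adj_gen; rewrite !inE eqxx.
- apply: adj_min hy'; first exact: adj_subring.
    by move=> x hx; do 2!apply: adj_base.
  by do !split; try (by apply: adj_gen; rewrite !inE eqxx ?orbT);
     apply: adj_base; apply: adj_gen; rewrite !inE eqxx ?orbT.
have lo z : adj R [:: c] z -> quot (adj R [:: c]) z by exact: quot_base.
have hi z : adj R [:: c; c^-1] z -> quot (adj R [:: c]) z.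
  have fc : quot (adj R [:: c]) c by apply: lo; apply: adj_gen; rewrite inE.
  apply: adj_min => //; first by move=> x hx; apply/lo/adj_base.
  by do !split=> //; exact: quot_inv.
have hs : adj R [:: c] S.[c] by apply: adj_horner => //; apply: adj_gen; rewrite inE.
have dE : d = S.[c] * b^-1 by rewrite -hbd; field.
have [|||||hpp hrr] := laurent_inj _ b p r p' (S.[c] *: scalep S.[c] r') hK hbc.2.
- by move=> i; exact: lo.
- by move=> i; exact: lo.
- by move=> i; exact: hi.
- by apply: polyinZ => //; [exact: lo|apply: polyin_scalep => //; [exact: lo|move=> i; exact: hi]].
- by rewrite -e e' hornerZ horner_scalep -dE {1}dE; ring.
have hr'' : polyin (adj R [:: c]) r'.
  (* The exponent is i + 1, not i, because of the factor d in front of r'(d). *)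
  move=> i; apply: (adj_cancel c S _ i.+1) => //.
  have := hr i; rewrite hrr coefZ coef_poly; case: ltnP => [_|le _].
    by rewrite exprS mulrCA.
  by rewrite nth_default // mul0r; exact: sr0.
have low z : adj R [:: c] z -> adj R [:: b; c; d] z.
  apply: adj_min => //; first exact: adj_base.
  by split=> //; apply: adj_gen; rewrite !inE eqxx ?orbT.
have gb : adj R [:: b; c; d] b by apply: adj_gen; rewrite !inE eqxx ?orbT.
have gd : adj R [:: b; c; d] d by apply: adj_gen; rewrite !inE eqxx ?orbT.
rewrite e' -hpp; apply: srD => //; last apply: srM => //.
  by apply: sr_horner => // i; exact: low.
by apply: sr_horner => // i; exact: low.
Qed.

End Exchange.
End Mutation.

Ltac in_gens := by apply: adj_gen; rewrite !inE eqxx ?orbT.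

(** * The triple intersection for an abstract sequence of exchange relations *)

Section StrongLaurent.
Context {F : fieldType}.
Implicit Types (D E R : F -> Prop) (P Q S : {poly F}) (y z : F).

(** Reversal relative to a degree bound l, up to a scalar of [R]. For the polynomials P_i and their
    reciprocals the scalar will be p_{i,l_i} or its inverse. *)
Definition reciprocal R P P' : Prop := exists l lam,
  [/\ (size P <= l.+1)%N, R lam & P' = lam *: \poly_(i < l.+1) P`_(l - i)].

Variables (R : F -> Prop) (hR : subring R).
Let hA s := adj_subring R s.

Lemma adj_cap_consecutive (a b c d y : F) Q S :
  polyin R Q -> polyin R S -> S`_0 = 1 -> a != 0 -> indep R b c ->
  d != 0 -> a * c = Q.[b] -> b * d = S.[c] ->
  adj R [:: a; a^-1; b; b^-1] y -> adj R [:: b; b^-1; c; c^-1] y ->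
  adj R [:: c; c^-1; d; d^-1] y -> adj R [:: a; b; c; d] y.
Proof.
move=> hQ hS S0 a0 hbc d0 hac hbd h1 h2 h3.
have hK s := quot_subring _ (hA s).
have c0 := trans_neq0 _ _ (hK _) hbc.1.
have b0 := trans_neq0 _ _ (hK _) hbc.2.
have quot_adj z w : adj R [:: z; z^-1] w -> quot (adj R [:: z]) w.
  have fz : quot (adj R [:: z]) z by apply: quot_base; [exact: hA|in_gens].
  apply: adj_min => // [u hu|]; first by apply: quot_base; [exact: hA|exact: adj_base].
  by do !split=> //; exact: quot_inv (hA _) fz.
have regroup s t u : allin (adj (adj R s) t) u -> adj R u y -> adj (adj R s) t y.
  by apply: adj_min; [exact: adj_subring|move=> z hz; do 2!apply: adj_base].
have ungroup s t u : allin (adj R u) s -> allin (adj R u) t ->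
    adj (adj R s) t y -> adj R u y.
  move=> hs ht; apply: adj_min => //.
  by move=> z; apply: adj_min => //; exact: adj_base.
have hU : adj R [:: b; b^-1; c; a] y.
  apply: (ungroup [:: b; b^-1] [:: c; a]); do ?split=> //; try in_gens.
  (* Q(b) need not be invertible in R[b^±1]; the expansions are therefore compared over the fraction
     field of R[b]. *)
  apply: (laurent_cap _ (quot (adj R [:: b])) a c Q.[b]) => //.
  - exact: quot_adj.
  - by move=> x; apply: quot_inv.
  - exact: hbc.1.
  - by apply: adj_horner => //; in_gens.
  - by rewrite -hac mulf_neq0.
  - by apply: regroup h2; do ?split=> //; try (by apply: adj_base; in_gens); in_gens.
  - by apply: regroup h1; do ?split=> //; try (by apply: adj_base; in_gens); in_gens.
have hL : adj R [:: c; c^-1; b; d] y.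
  apply: (ungroup [:: c; c^-1] [:: b; d]); do ?split=> //; try in_gens.
  apply: (laurent_cap _ (quot (adj R [:: c])) d b S.[c]) => //.
  - exact: quot_adj.
  - by move=> x; apply: quot_inv.
  - exact: hbc.2.
  - by apply: adj_horner => //; in_gens.
  - by rewrite -hbd mulf_neq0.
  - by rewrite mulrC.
  - by apply: regroup h2; do ?split=> //; try (by apply: adj_base; in_gens); in_gens.
  - by apply: regroup h3; do ?split=> //; try (by apply: adj_base; in_gens); in_gens.
have [|y1 [y2 [hy1 hy2 e]]] := adj_split R hR S a b c d y hS S0 b0 _ hbd hU.
  by rewrite hac; apply: adj_horner => //; in_gens.
rewrite e; apply: srD => //.
(* Since a = Q(b)/c, the summand [y1] also lies in R[c^±1, b, d], and so does y2 = y - y1;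
   [adj_cap_lower] then applies to [y2]. *)
suff : adj R [:: b; c; d] y2.
  by apply: adj_min => //; [exact: adj_base|do !split=> //; in_gens].
apply: (adj_cap_lower R hR S b c d) => //.
have -> : y2 = y - y1 by rewrite e; ring.
apply: srB => //; apply: adj_min hy1 => //; first exact: adj_base.
do !split=> //; try in_gens.
rewrite -[a](mulfK c0) hac; apply: srM => //; last in_gens.
by apply: adj_horner => //; in_gens.
Qed.

Variables (x : int -> F) (Q : int -> {poly F}).
Hypothesis hQ : forall k, polyin R (Q k).
Hypothesis hQ0 : forall k, (Q k)`_0 = 1.
Hypothesis hrel : forall k, x (k - 1) * x (k + 1) = (Q k).[x k].
Hypothesis hind : forall k, indep R (x k) (x (k + 1)).
Hypothesis hrec : forall k, reciprocal R (Q k) (Q (k + 2)).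
Hypothesis hrec' : forall k, reciprocal R (Q (k + 2)) (Q k).

Definition clusterT k := adj R [:: x k; (x k)^-1; x (k + 1); (x (k + 1))^-1].
(** The generators form an infinite family, so they enter through the base predicate and the list is
    empty. *)
Definition clusterA := adj (fun z => R z \/ exists k, z = x k) [::].
Let U k := adj R [:: x (k - 1); x k; x (k + 1); x (k + 2)].

Let x_neq0 k : x k != 0.
Proof. exact: trans_neq0 _ _ (quot_subring _ (hA _)) (hind k).2. Qed.

Let rel i j k : j = i + 1 -> k = i + 2 -> x i * x k = (Q j).[x j].
Proof.
by move=> -> ->; rewrite -hrel; congr (x _ * x _); ring.
Qed.

(** The two generating sets differ only in x_{k-1} and x_{k+3}. [adj_exchange] expresses each of
    them through the other set; for x_{k-1} the four variables are read in reverse order. *)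
Let U_step k y : U k y <-> U (k + 1) y.
Proof.
have e0 : k + 1 - 1 = k by ring.
have e2 : k + 1 + 1 = k + 2 by ring.
have e3 : k + 1 + 2 = k + 3 by ring.
have r1 : x (k - 1) * x (k + 1) = (Q k).[x k] by apply: rel; ring.
have r2 : x k * x (k + 2) = (Q (k + 1)).[x (k + 1)] by apply: rel; ring.
have r3 : x (k + 1) * x (k + 3) = (Q (k + 2)).[x (k + 2)] by apply: rel; ring.
rewrite /U e0 e2 e3; split; apply: adj_min => //; try exact: adj_base;
  do !split=> //; try in_gens.
  have [l [lam [sz hlam eQ]]] := hrec' k.
  have := adj_exchange R hR (Q (k + 2)) (Q k) (Q (k + 1))
    (x (k + 3)) (x (k + 2)) (x (k + 1)) (x k) (x (k - 1)) l lam.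
  move=> h; apply: adj_min (h _ _ _ _ _ _ _ _ _ _) => //; try exact: adj_base.
  - by do !split=> //; in_gens.
  - by rewrite mulrC.
  - by rewrite mulrC.
  - by rewrite mulrC.
have [l [lam [sz hlam eQ]]] := hrec k.
exact: (adj_exchange R hR (Q k) (Q (k + 2)) (Q (k + 1)) _ _ _ _ _ l lam).
Qed.

Let U_shift (n : nat) k y : U k y <-> U (k + n%:Z) y.
Proof.
elim: n => [|n IH]; first by rewrite addr0.
by rewrite IH U_step -addrA -PoszD addn1.
Qed.

Let x_in_U m k : U m (x k).
Proof.
have hk : U k (x k) by in_gens.
case: (lerP m k) => [le|/ltW le].
  apply/(U_shift `|k - m|%N); suff -> : m + `|k - m|%N = k by [].
  by rewrite gez0_abs ?subr_ge0 // subrKC.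
suff <- : k + `|m - k|%N = m by apply: (U_shift _ _ _).1.
by rewrite gez0_abs ?subr_ge0 // subrKC.
Qed.

Let A_sub_U m y : clusterA y -> U m y.
Proof.
apply: adj_min => // [|z [hz|[k ->]]]; [exact: hA|exact: adj_base|exact: x_in_U].
Qed.

Let U_sub_A m y : U m y -> clusterA y.
Proof.
apply: adj_min; first exact: adj_subring.
  by move=> z hz; apply: adj_base; left.
by do !split=> //; apply: adj_base; right; eexists.
Qed.

(** Only the outer generators need an argument: one exchange relation each gives x_{m-1} =
    Q_m(x_m)/x_{m+1} and x_{m+2} = Q_{m+1}(x_{m+1})/x_m. *)
Let U_sub_T m y : U m y -> clusterT m y.
Proof.
have ha : x (m - 1) * x (m + 1) = (Q m).[x m] by apply: rel; ring.
have hd : x m * x (m + 2) = (Q (m + 1)).[x (m + 1)] by apply: rel; ring.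
apply: adj_min; [exact: hA|exact: adj_base|do !split=> //; try in_gens].
  rewrite -[x (m - 1)](mulfK (x_neq0 (m + 1))) ha; apply: srM; [exact: hA| |in_gens].
  by apply: adj_horner => //; in_gens.
rewrite -[x (m + 2)](mulKf (x_neq0 m)) hd; apply: srM; [exact: hA|in_gens|].
by apply: adj_horner => //; in_gens.
Qed.

(** The Laurent phenomenon: all variables lie in [U k], whose four generators are Laurent
    polynomials in x_k and x_{k+1}. *)
Lemma clusterA_sub_T k y : clusterA y -> clusterT k y.
Proof. by move=> h; apply/U_sub_T/A_sub_U. Qed.

Lemma clusterT_cap_sub_A m y :
  clusterT (m - 1) y -> clusterT m y -> clusterT (m + 1) y -> clusterA y.
Proof.
rewrite /clusterT subrK => h1 h2 h3; apply: (U_sub_A m).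
have e2 : m + 1 + 1 = m + 2 by ring.
rewrite e2 in h3.
by apply: (adj_cap_consecutive _ _ _ _ _ (Q m) (Q (m + 1))) => //; apply: rel; ring.
Qed.

End StrongLaurent.

(** * Integer spans of multiplicatively closed families *)

Section IntegerSpan.
Context {F : fieldType} {I : Type}.
Variables (w : I -> F) (one : I) (op : I -> I -> I).
Hypotheses (w1 : w one = 1) (wM : forall i j, w (op i j) = w i * w j).

(** Common shape of [inT] and [inA]: [w] evaluates formal monomials, and [op] multiplies them. *)
Definition zspan y : Prop :=
  exists s : seq (int * I), y = \sum_(t <- s) t.1%:~R * w t.2.

Lemma zspan_gen i : zspan (w i).
Proof. by exists [:: (1, i)]; rewrite big_seq1 mul1r. Qed.

Lemma zspan_subring : subring zspan.
Proof.
split; first by rewrite -w1; exact: zspan_gen.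
- move=> _ _ [s ->] [t ->]; exists (s ++ [seq (- u.1, u.2) | u <- t]).
  rewrite big_cat big_map /= -sumrN; congr (_ + _).
  by apply: eq_bigr => u _; rewrite rmorphN mulNr.
- move=> _ _ [s ->] [t ->].
  exists [seq (u.1 * v.1, op u.2 v.2) | u <- s, v <- t].
  rewrite big_allpairs_dep mulr_suml; apply: eq_bigr => u _.
  rewrite mulr_sumr; apply: eq_bigr => v _ /=.
  by rewrite rmorphM wM /=; ring.
Qed.

Lemma zspan_min (E : F -> Prop) y :
  subring E -> (forall i, E (w i)) -> zspan y -> E y.
Proof.
move=> hE hw [s ->]; apply: sr_sum => // t _; apply: srM => //.
case: t.1 => n /=; last rewrite NegzE rmorphN /=; last apply: srN => //;
  by apply: srMn => //; exact: sr1.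
Qed.

End IntegerSpan.

Lemma sr_expz (F : fieldType) (E : F -> Prop) z n :
  subring E -> E z -> E z^-1 -> E (z ^ n).
Proof.
move=> hE hz hV; case: n => n; first by rewrite -exprnP; exact: srX.
by rewrite NegzE -exprnN -exprVn; exact: srX.
Qed.

(** * Transcendence of the variables of the fraction field *)

Section Variables.
Variables l1 l2 : nat.
Let F := Fld l1 l2.
Let MP := {mpoly int[nvars l1 l2]}.

(* Regards a polynomial as univariate in X_j over the field F. *)
Local Notation sepvar j :=
  (mmap (intr : int -> {poly F})
        (fun i => if i == j then 'X else (tofrac ('X_i : MP) : F)%:P)).

(** An integer polynomial without X_j is recognised by its image under [sepvar j] being constant. *)
Definition free_of (j : 'I_(nvars l1 l2)) (z : F) : Prop :=
  exists rho : MP, z = tofrac rho /\ sepvar j (rho : MP) = z%:P.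

Lemma free_of_subring j : subring (free_of j).
Proof.
split; first by exists 1; rewrite !rmorph1.
- move=> _ _ [u [-> eu]] [v [-> ev]]; exists (u - v).
  by split; [rewrite rmorphB|rewrite rmorphB /= eu ev polyCB].
- move=> _ _ [u [-> eu]] [v [-> ev]]; exists (u * v).
  by split; [rewrite rmorphM|rewrite rmorphM /= eu ev polyCM].
Qed.

Lemma free_of_X j i : i != j -> free_of j (tofrac ('X_i : MP)).
Proof.
move=> neq; exists 'X_i; split=> //.
by rewrite mmapX mmap1U (negPf neq).
Qed.

(** A relation p(X_j) = 0 already holds in the polynomial ring, and [sepvar j] maps its left side to
    p itself. *)
Lemma trans_free_of j : trans (free_of j) (tofrac ('X_j : MP) : F).
Proof.
move=> p hp p0.
have /fin_all_exists [f hf] : forall i : 'I_(size p),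
    exists rho : MP, p`_i = tofrac rho /\ sepvar j rho = (p`_i)%:P.
  by move=> i; have [rho h] := hp i; exists rho.
have : tofrac (\sum_(i < size p) f i * 'X_j ^+ i : MP) == 0 :> F.
  apply/eqP; apply: etrans p0; rewrite rmorph_sum [RHS]horner_coef.
  apply: eq_bigr => i _.
  by rewrite rmorphM rmorphXn (hf i).1.
rewrite tofrac_eq0 => /eqP /(congr1 (sepvar j)).
rewrite rmorph0 rmorph_sum /= => e; rewrite -[LHS]coefK poly_def -[RHS]e.
apply: eq_bigr => i _; rewrite rmorphM rmorphXn /= (hf i).2 -mul_polyC.
by rewrite mmapX mmap1U eqxx.
Qed.

(** The base ring Z[P]: the indices below l1 + l2 are those of the p_{i,k}. *)
Definition PLaurent : F -> Prop :=
  adj (fun z => exists i : 'I_(l1 + l2), z = var l1 l2 i \/ z = (var l1 l2 i)^-1) [::].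

Lemma PLaurent_subring : subring PLaurent.
Proof. exact: adj_subring. Qed.

Lemma var_neq0 i : var l1 l2 i != 0.
Proof.
by rewrite /var tofrac_eq0 -msize_poly_eq0 msizeX.
Qed.

Lemma PLaurent_var i : (i < l1 + l2)%N -> PLaurent (var l1 l2 i).
Proof. by move=> lt; apply: adj_base; exists (Ordinal lt); left. Qed.

Lemma PLaurent_varV i : (i < l1 + l2)%N -> PLaurent (var l1 l2 i)^-1.
Proof. by move=> lt; apply: adj_base; exists (Ordinal lt); right. Qed.

(** The bound on j makes X_j one of x_1, x_2. The fractions of polynomials free of X_j then contain
    Z[P] and the i-th variable, so transcendence over them restricts to the ring in question. *)
Lemma trans_adj_var i j : (i < nvars l1 l2)%N -> i != j ->
  (l1 + l2 <= j < nvars l1 l2)%N ->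
  trans (quot (adj PLaurent [:: var l1 l2 i])) (var l1 l2 j).
Proof.
move=> hi neq /andP[hj hj'].
have hF := free_of_subring (inord j).
have hQ := quot_subring _ hF.
have fv k : (k < nvars l1 l2)%N -> k != j -> quot (free_of (inord j)) (var l1 l2 k).
  move=> hk kj; apply: quot_base => //; apply: free_of_X.
  by rewrite -val_eqE /= !inordK.
have [hV hT] := (fun z => quot_inv _ z hF, trans_quot _ _ hF (trans_free_of (inord j))).
apply: trans_mono hT => z; apply: quot_min => // u; apply: adj_min => //.
  move=> v; apply: adj_min => // w [k hk].
  have fk : quot (free_of (inord j)) (var l1 l2 k).
    apply: fv; first by rewrite /nvars ltnS ltnW // ltnS ltnW.
    by rewrite ltn_eqF // (leq_trans (ltn_ord k)).
  by case: hk => -> //; exact: quot_inv.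
by split=> //; exact: fv.
Qed.

End Variables.

(** * The concrete rank two sequence and its identification with the abstract one *)

Section RankTwo.
Variables (l1 l2 : nat) (hl1 : (0 < l1)%N) (hl2 : (0 < l2)%N).
Local Notation F := (Fld l1 l2).
Local Notation R := (PLaurent l1 l2).
Local Notation pv := (pv l1 l2).
Local Notation ell := (ell l1 l2).
Local Notation xs := (xs l1 l2).
Local Notation fwd := (fwd l1 l2).
Local Notation bwd := (bwd l1 l2).
Let hR : subring R := PLaurent_subring l1 l2.

Let ell_gt0 i : (0 < ell i)%N.
Proof. by rewrite /ell; case: ifP. Qed.

Let pv0 i : pv i 0 = 1. Proof. by []. Qed.

Let pv_var i k : (0 < k <= ell i)%N -> exists2 j, (j < l1 + l2)%N & pv i k = var l1 l2 j.
Proof.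
case: k => // k; rewrite /pv /ell /=; case: eqP => _ hk; eexists; try reflexivity.
  exact: ltn_addr.
by rewrite ltn_add2l.
Qed.

Let pv_in i k : (k <= ell i)%N -> R (pv i k).
Proof.
case: k => [_|k hk]; first by rewrite pv0; exact: sr1.
by have [j hj ->] := pv_var i k.+1 hk; exact: PLaurent_var.
Qed.

Let lead_inv_in i : R (pv i (ell i))^-1.
Proof.
have [|j hj ->] := pv_var i (ell i); last exact: PLaurent_varV.
by rewrite leqnn ell_gt0.
Qed.

Let lead_neq0 i : pv i (ell i) != 0.
Proof.
have [|j hj ->] := pv_var i (ell i); last exact: var_neq0.
by rewrite leqnn ell_gt0.
Qed.

Definition Ppoly i : {poly F} := \poly_(k < (ell i).+1) pv i k.
Definition Pbarpoly i : {poly F} :=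
  (pv i (ell i))^-1 *: \poly_(k < (ell i).+1) pv i (ell i - k).

Definition Qpoly (k : int) : {poly F} :=
  let r := (k %% 4)%Z in
  if r == 1 then Ppoly 1 else if r == 2 then Ppoly 2
  else if r == 3 then Pbarpoly 1 else Pbarpoly 2.

Lemma horner_Qpoly k z : (Qpoly k).[z] = Qk l1 l2 k z.
Proof.
have e1 i : (Ppoly i).[z] = Ppol l1 l2 i z by rewrite horner_poly /Ppol big_mkord.
have e2 i : (Pbarpoly i).[z] = Pbar l1 l2 i z.
  rewrite hornerZ horner_poly /Pbar big_mkord mulrC; congr (_ / _).
  rewrite (reindex_inj rev_ord_inj); apply: eq_bigr => j _ /=.
  by rewrite subSS subKn // leq_ord.
by rewrite /Qpoly /Qk; do 3?case: ifP.
Qed.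

Lemma Qpoly_coef0 k : (Qpoly k)`_0 = 1.
Proof.
have e1 i : (Ppoly i)`_0 = 1 by rewrite coef_poly.
have e2 i : (Pbarpoly i)`_0 = 1 by rewrite coefZ coef_poly subn0 mulVf.
by rewrite /Qpoly; do 3?case: ifP.
Qed.

Lemma Qpoly_in k : polyin R (Qpoly k).
Proof.
have e1 i : polyin R (Ppoly i).
  by apply: polyin_poly => // j; rewrite ltnS; exact: pv_in.
have e2 i : polyin R (Pbarpoly i).
  apply: polyinZ => //; apply: polyin_poly => // j _.
  by apply: pv_in; exact: leq_subr.
by rewrite /Qpoly; do 3?case: ifP.
Qed.

(** Adding 2 modulo 4 exchanges P_i with its reciprocal for the same i, and reversing twice returns
    P_i once the leading coefficient is cancelled. *)
Lemma Qpoly_reciprocal k :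
  reciprocal R (Qpoly k) (Qpoly (k + 2)) /\ reciprocal R (Qpoly (k + 2)) (Qpoly k).
Proof.
have e1 i : reciprocal R (Ppoly i) (Pbarpoly i).
  exists (ell i), (pv i (ell i))^-1; split=> //; first exact: size_poly.
  congr (_ *: _); apply/polyP => j; rewrite !coef_poly; case: ifP => // hj.
  by rewrite ltnS leq_subr.
have e2 i : reciprocal R (Pbarpoly i) (Ppoly i).
  exists (ell i), (pv i (ell i)); split.
  - exact: leq_trans (size_scale_leq _ _) (size_poly _ _).
  - exact: pv_in.
  - apply/polyP => j; rewrite coefZ !coef_poly; case: ifP => hj; last by rewrite mulr0.
    by rewrite coefZ coef_poly ltnS leq_subr mulVKf // subKn.
rewrite /Qpoly.
have : exists2 n, (n < 4)%N & (k %% 4)%Z = n%:Z.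
  by exists (absz (k %% 4)%Z); lia.
case=> n lt_n e; rewrite -(modzDml k 2 4) e.
by case: n lt_n {e} => [|[|[|[|//]]]] _ /=; split.
Qed.

Let indep_base : indep R (xs 1) (xs 2).
Proof. by split; apply: trans_adj_var; rewrite /nvars ?eqn_leq ?ltnn //; lia. Qed.

Let Qneq0 k : Qpoly k != 0.
Proof. exact: coef0_eq1_neq0 (Qpoly_coef0 k). Qed.

Let fwd_indep n : indep R (fwd n).1 (fwd n).2.
Proof.
elim: n => [|n IH] /=; first exact: indep_base.
rewrite -horner_Qpoly; apply: indep_mutation => //; exact: Qpoly_in.
Qed.

Let bwd_indep n : indep R (bwd n).1 (bwd n).2.
Proof.
elim: n => [|n IH] /=; first exact: indep_base.
rewrite -horner_Qpoly; apply/indep_sym/indep_mutation => //; first exact: Qpoly_in.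
exact: indep_sym.
Qed.

Let xs_fwd (n : nat) : xs (n%:Z + 1) = (fwd n).1.
Proof. by rewrite /xs (_ : 1 <= _) ?addrK //; lia. Qed.

Let xs_fwd2 (n : nat) : xs (n%:Z + 2) = (fwd n).2.
Proof. by rewrite -[RHS]/(fwd n.+1).1 -xs_fwd; congr xs; lia. Qed.

Let xs_bwd (n : nat) : xs (1 - n%:Z) = (bwd n).1.
Proof.
case: n => [|n]; first by [].
rewrite /xs; case: ifP => [|_]; first by lia.
by congr (bwd _).1; lia.
Qed.

Let xs_bwd2 (n : nat) : xs (2 - n%:Z) = (bwd n).2.
Proof.
case: n => [|n]; first by [].
by rewrite -[RHS]/(bwd n).1 -xs_bwd; congr xs; lia.
Qed.

(** For k >= 2 the relation at k is the one by which [fwd] defines x_{k+1}; for k <= 1 it is the one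
    by which [bwd] defines x_{k-1}. *)
Let int_cases (k : int) : (exists n : nat, k = n%:Z + 2) \/ (exists n : nat, k = 1 - n%:Z).
Proof.
case: (lerP 2 k) => h; [left; exists `|k - 2|%N|right; exists `|1 - k|%N]; lia.
Qed.

Lemma xs_indep k : indep R (xs k) (xs (k + 1)).
Proof.
case: (int_cases k) => -[n ->].
  have -> : n%:Z + 2 = n.+1%:Z + 1 by lia.
  have -> : n.+1%:Z + 1 + 1 = n.+1%:Z + 2 by lia.
  by rewrite xs_fwd xs_fwd2; exact: fwd_indep.
have -> : 1 - n%:Z + 1 = 2 - n%:Z by lia.
by rewrite xs_bwd xs_bwd2; exact: bwd_indep.
Qed.

Lemma xs_neq0 k : xs k != 0.
Proof. exact: trans_neq0 _ _ (quot_subring _ (adj_subring _ _)) (xs_indep k).2. Qed.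

Lemma xs_rel k : xs (k - 1) * xs (k + 1) = (Qpoly k).[xs k].
Proof.
rewrite horner_Qpoly; case: (int_cases k) => -[n ->].
  have -> : n%:Z + 2 - 1 = n%:Z + 1 by lia.
  have -> : n%:Z + 2 + 1 = n.+1%:Z + 2 by lia.
  have x0 := xs_neq0 (n%:Z + 1).
  rewrite !xs_fwd2 xs_fwd /= mulrC divfK -?xs_fwd //.
  by congr (Qk _ _ _ _); lia.
have -> : 1 - n%:Z - 1 = 1 - n.+1%:Z by lia.
have -> : 1 - n%:Z + 1 = 2 - n%:Z by lia.
have x0 := xs_neq0 (2 - n%:Z).
by rewrite !xs_bwd xs_bwd2 /= divfK -?xs_bwd2.
Qed.

Let pmono1 : pmono l1 l2 [ffun=> 0] = 1.
Proof. by rewrite /pmono big1 // => i _; rewrite ffunE expr0z. Qed.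

Let pmonoD (e f : {ffun 'I_(l1 + l2) -> int}) :
  pmono l1 l2 [ffun i => e i + f i] = pmono l1 l2 e * pmono l1 l2 f.
Proof.
rewrite /pmono -big_split; apply: eq_bigr => i _ /=.
by rewrite ffunE expfzDr // var_neq0.
Qed.

Let pmono_in e : R (pmono l1 l2 e).
Proof.
apply: sr_prod => // i _; apply: sr_expz => //.
  by apply: PLaurent_var.
by apply: PLaurent_varV.
Qed.

Let pmono_var (i : 'I_(l1 + l2)) (n : int) :
  pmono l1 l2 [ffun j => if j == i then n else 0] = var l1 l2 i ^ n.
Proof.
rewrite /pmono (bigD1 i) //= ffunE eqxx big1 ?mulr1 // => j /negPf ji.
by rewrite ffunE ji expr0z.
Qed.

(** Laurent monomials multiply by adding exponents, the variables being nonzero, so their integer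
    span is a subring; it contains the generators and lies in the ring they generate. *)
Lemma inT_clusterT k y : inT l1 l2 k y <-> clusterT R xs k y.
Proof.
pose w (t : {ffun 'I_(l1 + l2) -> int} * int * int) :=
  pmono l1 l2 t.1.1 * xs k ^ t.1.2 * xs (k + 1) ^ t.2.
pose op (t u : {ffun 'I_(l1 + l2) -> int} * int * int) :=
  ([ffun i => t.1.1 i + u.1.1 i], t.1.2 + u.1.2, t.2 + u.2).
have w1 : w ([ffun=> 0], 0, 0) = 1 by rewrite /w pmono1 !expr0z !mul1r.
have wM t u : w (op t u) = w t * w u.
  by rewrite /w /= pmonoD !expfzDr ?xs_neq0 //; ring.
have hS := zspan_subring w _ op w1 wM.
have -> : inT l1 l2 k y <-> zspan w y.
  split=> -[s ->].
    exists [seq (t.1.1.1, (t.1.1.2, t.1.2, t.2)) | t <- s].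
    by rewrite big_map; apply: eq_bigr => t _; rewrite /w /= !mulrA.
  exists [seq (t.1, t.2.1.1, t.2.1.2, t.2.2) | t <- s].
  by rewrite big_map; apply: eq_bigr => t _; rewrite /w /= !mulrA.
have hT : subring (clusterT R xs k) by exact: adj_subring.
split.
  apply: zspan_min => // t; rewrite /w; apply: srM => //; first apply: srM => //.
  - exact/adj_base/pmono_in.
  - by apply: sr_expz => //; in_gens.
  - by apply: sr_expz => //; in_gens.
have gen e a b z : w (e, a, b) = z -> zspan w z by move=> <-; exact: zspan_gen.
apply: adj_min => //.
  move=> z; apply: adj_min => // u [i [] ->].
    apply: (gen [ffun j => if j == i then 1 else 0] 0 0).
    by rewrite /w pmono_var !expr0z !mulr1 expr1z.
  apply: (gen [ffun j => if j == i then -1 else 0] 0 0).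
  by rewrite /w pmono_var !expr0z !mulr1.
split; first by apply: (gen [ffun=> 0] 1 0); rewrite /w pmono1 expr0z expr1z mul1r mulr1.
split; first by apply: (gen [ffun=> 0] (-1) 0); rewrite /w pmono1 expr0z mul1r mulr1.
split; first by apply: (gen [ffun=> 0] 0 1); rewrite /w pmono1 expr0z expr1z !mul1r.
split=> //; by apply: (gen [ffun=> 0] 0 (-1)); rewrite /w pmono1 expr0z !mul1r.
Qed.

(** As for [inT], with words in the x_k, multiplied by concatenation, in place of the two
    exponents. *)
Lemma inA_clusterA y : inA l1 l2 y <-> clusterA R xs y.
Proof.
pose w (t : {ffun 'I_(l1 + l2) -> int} * seq int) :=
  pmono l1 l2 t.1 * \prod_(k <- t.2) xs k.
pose op (t u : {ffun 'I_(l1 + l2) -> int} * seq int) :=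
  ([ffun i => t.1 i + u.1 i], t.2 ++ u.2).
have w1 : w ([ffun=> 0], [::]) = 1 by rewrite /w pmono1 big_nil mul1r.
have wM t u : w (op t u) = w t * w u.
  by rewrite /w /= pmonoD big_cat /=; ring.
have hS := zspan_subring w _ op w1 wM.
have -> : inA l1 l2 y <-> zspan w y.
  split=> -[s ->].
    exists [seq (t.1.1, (t.1.2, t.2)) | t <- s].
    by rewrite big_map; apply: eq_bigr => t _; rewrite /w /= !mulrA.
  exists [seq (t.1, t.2.1, t.2.2) | t <- s].
  by rewrite big_map; apply: eq_bigr => t _; rewrite /w /= !mulrA.
have hA : subring (clusterA R xs) by exact: adj_subring.
split.
  apply: zspan_min => // t; rewrite /w; apply: srM => //.
    by apply: adj_base; left; exact: pmono_in.
  by apply: sr_prod => // k _; apply: adj_base; right; exists k.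
have gen e s z : w (e, s) = z -> zspan w z by move=> <-; exact: zspan_gen.
apply: adj_min => // z [|[k ->]]; last first.
  by apply: (gen [ffun=> 0] [:: k]); rewrite /w pmono1 big_seq1 mul1r.
apply: adj_min => // u [i [] ->].
  apply: (gen [ffun j => if j == i then 1 else 0] [::]).
  by rewrite /w pmono_var big_nil mulr1 expr1z.
apply: (gen [ffun j => if j == i then -1 else 0] [::]).
by rewrite /w pmono_var big_nil mulr1.
Qed.

Lemma inA_sub_inT k y : inA l1 l2 y -> inT l1 l2 k y.
Proof.
move=> /inA_clusterA h; apply/inT_clusterT.
by apply: clusterA_sub_T h; [exact: hR|exact: Qpoly_in|exact: Qpoly_coef0
  |exact: xs_rel|exact: xs_indep|move=> j; exact: (Qpoly_reciprocal j).1
  |move=> j; exact: (Qpoly_reciprocal j).2].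
Qed.

Lemma inT_cap_sub_inA m y :
  inT l1 l2 (m - 1) y -> inT l1 l2 m y -> inT l1 l2 (m + 1) y -> inA l1 l2 y.
Proof.
move=> /inT_clusterT h1 /inT_clusterT h2 /inT_clusterT h3; apply/inA_clusterA.
by apply: clusterT_cap_sub_A h1 h2 h3; [exact: hR|exact: Qpoly_in|exact: Qpoly_coef0
  |exact: xs_rel|exact: xs_indep].
Qed.

End RankTwo.

Theorem theoremA3 (l1 l2 : nat) (hl1 : (0 < l1)%N) (hl2 : (0 < l2)%N) (m : int) :
  (forall y : Fld l1 l2, inA l1 l2 y <-> (forall k : int, inT l1 l2 k y)) /\
  (forall y : Fld l1 l2,
     inA l1 l2 y <-> (inT l1 l2 (m - 1) y /\ inT l1 l2 m y /\ inT l1 l2 (m + 1) y)).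
Proof.
have sub k y : inA l1 l2 y -> inT l1 l2 k y by exact: inA_sub_inT.
have cap y := inT_cap_sub_inA l1 l2 hl1 hl2 m y.
split=> y; split=> [h|h].
- by move=> k; exact: sub.
(* The instances at m - 1, m and m + 1 already force membership in A. *)
- by apply: cap; exact: h.
- by do !split; exact: sub.
- by case: h => h1 [h2 h3]; exact: cap.
Qed.
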